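(* Let $A,B,C,D,E$ be sets of positive integers, each of which is either finite or a union of arithmetic progressions. Let $u,d,f$ be the integer-valued functions on pairs $(m,n)$ with $m\ge 0$ and $n\in\mathbb{Z}$ determined by the initial values $u(0,0)=f(0,0)=0$, $d(0,0)=1$, by the boundary conditions $u(m,n)=d(m,n)=f(m,n)=0$ whenever $n>m$ or $n<0$, and, for $m\ge 1$ and $0\le n\le m$, by the recurrences $$d(m,n)=\sum_{\substack{1\le r\le m\\ r\notin D}}\bigl(u_d(m-r,n+r)+f_d(m-r,n+r)\bigr),$$ $$f(m,n)=\sum_{\substack{1\le r\le m\\ r\notin E}}\bigl(d(m-r,n)+u(m-r,n)\bigr),$$ $$u(m,n)=\sum_{\substack{1\le r\le m\\ r\notin C}}\bigl(d_u(m-r,n-r)+f_u(m-r,n-r)\bigr),$$ where $u_d(m,n)=0$ if $n\in A$ and $u_d(m,n)=u(m,n)$ otherwise; $d_u(m,n)=0$ if $n\in B$ and $d_u(m,n)=d(m,n)$ otherwise; and $$f_u(m,n)=\sum_{\substack{1\le r\le m\\ r\notin E}}\bigl(u(m-r,n)+d_u(m-r,n)\bigr),\qquad f_d(m,n)=\sum_{\substack{1\le r\le m\\ r\notin E}}\bigl(u_d(m-r,n)+d(m-r,n)\bigr).$$ Then for every $N\ge 0$, the number of Motzkin paths of length $N$ that have no peak of height in $A$, no valley of height in $B$, no upward-run of length in $C$, no downward-run of length in $D$, and no flat-run of length in $E$ is equal to $d(N,0)+f(N,0)$.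
   Context: A Motzkin path of length $n$ is a walk in the plane from $(0,0)$ to $(n,0)$ with steps $U=(1,1)$, $D=(1,-1)$, $F=(1,0)$ that never goes below the $x$-axis; the empty path is the Motzkin path of length $0$. (The letter $D$ denotes both the down-step and one of the sets of forbidden lengths; the meaning is clear from usage.) For a step $L$, $L^k$ denotes $k$ consecutive copies of $L$. A peak is a block of consecutive steps $UF^kD$ with $k\ge 0$; its height is the $y$-coordinate of the path right after the step $U$ of the block. A valley is a block of consecutive steps $DF^kU$ with $k\ge 0$; its height is the $y$-coordinate right after the step $D$ of the block. An upward-run (respectively downward-run, flat-run) of length $k\ge 1$ is a maximal block of $k$ consecutive $U$ steps (respectively $D$ steps, $F$ steps), i.e. one neither immediately preceded nor immediately followed by a step of the same kind. Empty sums are $0$. *)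

(* Defs.v *)
From HB Require Import structures.
From mathcomp Require Import all_boot all_order all_algebra.
From mathcomp Require Import boolp classical_sets cardinality.

Set Implicit Arguments.
Unset Strict Implicit.
Unset Printing Implicit Defensive.

Import Order.TTheory GRing.Theory Num.Theory.

Local Open Scope ring_scope.
Local Open Scope classical_set_scope.

Inductive step := Up | Down | Flat.

Definition step_code (s : step) : option bool :=
  match s with Up => Some true | Down => Some false | Flat => None end.

Definition step_decode (c : option bool) : step :=
  match c with Some true => Up | Some false => Down | None => Flat end.

Lemma step_codeK : cancel step_code step_decode.
Proof. by case. Qed.

HB.instance Definition _ := Finite.copy step (can_type step_codeK).

Definition rise (s : step) : int :=
  match s with Up => 1 | Down => -1 | Flat => 0 end.

(* The y-coordinate reached from the x-axis after the steps of p. *)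
Definition height (p : seq step) : int := \sum_(s <- p) rise s.

Definition motzkin (p : seq step) : Prop :=
  (forall i : nat, 0 <= height (take i p)) /\ height p = 0.

Definition has_peak (p : seq step) (h : int) : Prop :=
  exists (p1 p2 : seq step) (k : nat),
    p = p1 ++ [:: Up] ++ nseq k Flat ++ [:: Down] ++ p2 /\
    h = height (p1 ++ [:: Up]).

Definition has_valley (p : seq step) (h : int) : Prop :=
  exists (p1 p2 : seq step) (k : nat),
    p = p1 ++ [:: Down] ++ nseq k Flat ++ [:: Up] ++ p2 /\
    h = height (p1 ++ [:: Down]).

(* The last two conditions express maximality: the block is neither preceded
   nor followed by a step s. *)
Definition has_run (s : step) (p : seq step) (k : nat) : Prop :=
  (0 < k)%N /\
  exists p1 p2 : seq step,
    [/\ p = p1 ++ nseq k s ++ p2,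
        ohead (rev p1) <> Some s
      & ohead p2 <> Some s].

Definition restricted_motzkin (A B C D E : set int) (p : seq step) : Prop :=
  [/\ motzkin p,
      forall h : int, has_peak p h -> ~ A h,
      forall h : int, has_valley p h -> ~ B h
    & [/\ forall k : nat, has_run Up p k -> ~ C k%:Z,
          forall k : nat, has_run Down p k -> ~ D k%:Z
        & forall k : nat, has_run Flat p k -> ~ E k%:Z]].

Definition arith_prog (a : int) (b : nat) : set int :=
  [set x | exists k : nat, x = a + (b * k)%N%:Z].

(* Progressions are infinite (positive difference), since allowing singletons
   would make every set such a union; the family may be infinite. *)
Definition union_of_arith_progs (S : set int) : Prop :=
  exists I : set (int * nat),
    (forall i, I i -> (0 < i.2)%N) /\
    S = \bigcup_(i in I) arith_prog i.1 i.2.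

Definition admissible (S : set int) : Prop :=
  (forall x, S x -> 0 < x) /\ (finite_set S \/ union_of_arith_progs S).

Definition u_d (A : set int) (u : nat -> int -> int) (m : nat) (n : int) : int :=
  if n \in A then 0 else u m n.

Definition d_u (B : set int) (d : nat -> int -> int) (m : nat) (n : int) : int :=
  if n \in B then 0 else d m n.

Definition f_u (B E : set int) (u d : nat -> int -> int) (m : nat) (n : int)
    : int :=
  \sum_(1 <= r < m.+1 | r%:Z \notin E) (u (m - r)%N n + d_u B d (m - r)%N n).

Definition f_d (A E : set int) (u d : nat -> int -> int) (m : nat) (n : int)
    : int :=
  \sum_(1 <= r < m.+1 | r%:Z \notin E) (u_d A u (m - r)%N n + d (m - r)%N n).

(* Main.v *)
(** Read prefixes of paths from left to right and peel off the last maximal run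
    [s^r]: the prefix [q s^r] is admissible iff [q] is admissible, [r] is an
    allowed run length, the path stays above the axis, and [q] does not end in
    [U F^k] (for [s = D]) or [D F^k] (for [s = U]) starting at a forbidden
    height.  Hence [u], [d], [f] count the admissible prefixes by length, final
    height and last step, while [u_d], [f_d], [d_u], [f_u] count those which may
    moreover be continued by [D], resp. [U].  The value [d(0,0) = 1] makes the
    empty prefix count as one ending in [D]; since [0] is not in [B], no valley
    condition ever applies to it. *)

Require Import Defs.
From mathcomp Require Import all_boot all_order all_algebra.
From mathcomp Require Import boolp classical_sets cardinality.
From mathcomp Require Import zify.

Set Implicit Arguments.
Unset Strict Implicit.
Unset Printing Implicit Defensive.

Import Order.TTheory GRing.Theory Num.Theory.

Local Open Scope ring_scope.

(** * Counting words of fixed length and removing their last run *)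

Definition cnt (m : nat) (P : seq step -> Prop) : int :=
  \sum_(p : m.-tuple step | `[< P p >]) 1.

Lemma cntE m (P : seq step -> Prop) :
  cnt m P = #|[pred p : m.-tuple step | `[< P p >]]|%:Z.
Proof. by rewrite /cnt sumr_const natz. Qed.

Lemma eq_cnt m (P Q : seq step -> Prop) :
  (forall p, size p = m -> P p <-> Q p) -> cnt m P = cnt m Q.
Proof.
move=> PQ; apply: eq_bigl => p; apply/asboolP/asboolP => Hp;
  by apply/PQ; rewrite ?size_tuple.
Qed.

Lemma cnt_eq0 m (P : seq step -> Prop) :
  (forall p, size p = m -> ~ P p) -> cnt m P = 0.
Proof.
by move=> nP; apply: big_pred0 => p; apply/asboolP/nP; rewrite size_tuple.
Qed.

Lemma cnt_nil (P : seq step -> Prop) : P [::] -> cnt 0 P = 1.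
Proof.
move=> P0; rewrite /cnt (bigD1 [tuple]) /=; last exact/asboolP.
by rewrite big1 ?addr0 // => p /andP[_]; rewrite [p]tuple0 => /eqP[]; apply: val_inj.
Qed.

Lemma cntID m (Q P : seq step -> Prop) :
  cnt m P = cnt m (fun p => P p /\ Q p) + cnt m (fun p => P p /\ ~ Q p).
Proof.
rewrite /cnt (bigID (fun p : m.-tuple step => `[< Q p >])) /=.
by congr (_ + _); apply: eq_bigl => p; rewrite asbool_and ?asbool_neg.
Qed.

(** Appending [s] is a bijection onto the words of length [m.+1] ending in [s]; these are nonempty,
    so the default of [last] never intervenes. *)
Lemma cnt_last m s (P : seq step -> Prop) :
  cnt m.+1 (fun p => P p /\ last Down p = s) = cnt m (fun p => P (rcons p s)).
Proof.
rewrite /cnt (reindex_onto (fun t : m.-tuple step => [tuple of rcons t s])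
  (fun p => [tuple of belast (thead p) (behead p)])) /=; last first.
  move=> p /asboolP[_]; case/tupleP: p => x p /= <-.
  by apply: val_inj; rewrite /= theadE -lastI.
apply: eq_bigl => p; apply/andP/asboolP => [[/asboolP[]]//|Pp]; split.
  by apply/asboolP; rewrite last_rcons.
apply/eqP/val_inj => /=.
by case: p {Pp} => -[|x p] //= sp; rewrite belast_rcons.
Qed.

Lemma cat_nseqS (T : Type) (q : seq T) r s :
  q ++ nseq r.+1 s = rcons (q ++ nseq r s) s.
Proof. by rewrite -addn1 nseqD catA cats1. Qed.

(* The side condition discards the word [s^m] when [s = Down]: with the default
   [Down] of [last], removing its only run would leave a word ending in [Down]. *)
Lemma cnt_runs m s (P : seq step -> Prop) :
  (s = Down -> ~ P (nseq m s)) ->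
  cnt m (fun p => P p /\ last Down p = s) =
  \sum_(1 <= r < m.+1)
     cnt (m - r) (fun q => P (q ++ nseq r s) /\ last Down q <> s).
Proof.
elim: m P => [|m IH] P nP.
  rewrite big_geq // cnt_eq0 // => p /size0nil -> /= [P0 Es].
  exact: nP P0.
(* Either the step before the final [s] is again [s], and induction removes the rest of the run, or
   the run has length 1, the first term of the sum. *)
rewrite cnt_last (cntID _ (fun p => last Down p = s)).
rewrite IH; last first.
  by move=> Es; have := nP Es; rewrite -[nseq _.+1 s]cat0s cat_nseqS.
rewrite [in RHS]big_nat_recl // addrC subSS subn0; congr (_ + _).
  by apply: eq_cnt => p _; rewrite cats1.
apply: eq_big_nat => r _; rewrite subSS.
by apply: eq_cnt => q _; rewrite cat_nseqS.
Qed.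

(** * Heights and staying above the axis *)

Lemma height_rcons p s : height (rcons p s) = height p + rise s.
Proof. by rewrite /height -cats1 big_cat big_seq1. Qed.

Lemma height_cat_nseq q r s :
  height (q ++ nseq r s) = height q + r%:Z * rise s.
Proof.
elim: r => [|r IH]; first by rewrite cats0 mul0r addr0.
by rewrite cat_nseqS height_rcons IH intS mulrDl mul1r -addrA [rise s + _]addrC.
Qed.

Definition nonneg (p : seq step) : Prop :=
  forall i : nat, 0 <= height (take i p).

Lemma nonneg_height p : nonneg p -> 0 <= height p.
Proof. by move=> /(_ (size p)); rewrite take_size. Qed.

Lemma nonneg_rcons p s :
  nonneg (rcons p s) <-> nonneg p /\ 0 <= height (rcons p s).
Proof.
split=> [Hp|[Hp Hs] i].
  split; last exact: nonneg_height.
  move=> i; have [/take_oversize ->|lt_ip] := leqP (size p) i.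
    by have := Hp (size p); rewrite -cats1 take_size_cat.
  by have := Hp i; rewrite -cats1 takel_cat // ltnW.
have [lt_pi|le_ip] := ltnP (size p) i.
  by rewrite take_oversize ?size_rcons.
by rewrite -cats1 takel_cat.
Qed.

Lemma height_size p : height p <= (size p)%:Z.
Proof.
elim/last_ind: p => [|p s IH]; first by rewrite /height big_nil.
by rewrite height_rcons size_rcons; case: s => /=; lia.
Qed.

(** Height is monotone along a run, so its lowest point is at one of the two ends, and [nonneg q]
    covers the first. *)
Lemma nonneg_cat_nseq q r s :
  nonneg (q ++ nseq r s) <-> nonneg q /\ 0 <= height q + r%:Z * rise s.
Proof.
elim: r => [|r IH].
  rewrite cats0 mul0r addr0; split=> [Hq|[]//]; split=> //.
  exact: nonneg_height.
rewrite cat_nseqS nonneg_rcons IH -cat_nseqS height_cat_nseq.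
split=> [[[]]//|[Hq Hr]]; split=> //; split=> //.
by have := nonneg_height Hq; case: s Hr {IH} => /=; lia.
Qed.

(** * Peaks and valleys when a word is extended *)

(* [turn Up Down] is [has_peak] and [turn Down Up] is [has_valley]. *)
Definition turn (a b : step) (p : seq step) (h : int) : Prop :=
  exists (p1 p2 : seq step) (k : nat),
    p = p1 ++ [:: a] ++ nseq k Flat ++ [:: b] ++ p2 /\
    h = height (p1 ++ [:: a]).

(** A peak or valley that has begun at the end of [p]; the next non-flat step decides whether it is
    completed. *)
Definition open_turn (a : step) (p : seq step) (h : int) : Prop :=
  exists (p1 : seq step) (k : nat),
    p = rcons p1 a ++ nseq k Flat /\ h = height (rcons p1 a).

Lemma turn_rcons a b p s h :
  turn a b (rcons p s) h <-> turn a b p h \/ s = b /\ open_turn a p h.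
Proof.
split.
  case=> p1 [p2 [k [+ ->]]]; case/lastP: p2 => [|p2 x].
    rewrite cats0 catA cats1 catA cats1 => /rcons_inj[-> ->].
    by right; split=> //; exists p1, k.
  rewrite -!rcons_cat => /rcons_inj[-> _].
  by left; exists p1, p2, k.
case=> [[p1 [p2 [k [-> ->]]]]|[-> [p1 [k [-> ->]]]]].
  by exists p1, (rcons p2 s), k; rewrite -!rcons_cat.
exists p1, [::], k; rewrite cats1; split=> //.
by rewrite -!cats1 -!catA.
Qed.

Lemma open_turn_rcons a p s h : a <> Flat ->
  open_turn a (rcons p s) h <->
  s = a /\ h = height p + rise a \/ s = Flat /\ open_turn a p h.
Proof.
move=> aF; split.
  case=> p1 [[|k] [+ ->]].
    by rewrite cats0 => /rcons_inj[-> ->]; left; rewrite height_rcons.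
  by rewrite cat_nseqS => /rcons_inj[-> ->]; right; split=> //; exists p1, k.
case=> [[-> ->]|[-> [p1 [k [-> ->]]]]].
  by exists p, 0%N; rewrite cats0 height_rcons.
by exists p1, k.+1; rewrite cat_nseqS.
Qed.

Lemma open_turn_nil a h : ~ open_turn a [::] h.
Proof. by case=> -[|x p1] [k []]. Qed.

Lemma open_turn_last a p h : a <> Flat ->
  open_turn a p h -> last Down p = a \/ last Down p = Flat.
Proof.
case/lastP: p => [|p s] aF; first by move/open_turn_nil.
by move/(open_turn_rcons _ _ _ aF); rewrite last_rcons; case=> [[]|[]]; auto.
Qed.

Lemma open_turn_flats a q r h : a <> Flat ->
  open_turn a (q ++ nseq r Flat) h <-> open_turn a q h.
Proof.
move=> aF; elim: r => [|r IH]; first by rewrite cats0.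
rewrite cat_nseqS open_turn_rcons // IH; split; last by right.
by case=> [[Ea]|[]//]; case: aF.
Qed.

(** Only the first step of the run can complete a turn: every later one follows a step [b], whereas
    an open turn ends in [a] or [Flat]. *)
Lemma turn_cat_nseq a b q r s h : a <> Flat -> b <> Flat -> a <> b ->
  turn a b (q ++ nseq r.+1 s) h <->
  turn a b q h \/ s = b /\ open_turn a q h.
Proof.
move=> aF bF ab; elim: r => [|r IH]; first by rewrite cats1 turn_rcons.
rewrite cat_nseqS turn_rcons IH; split; last by left.
case=> // -[Es]; rewrite cat_nseqS open_turn_rcons // => -[[Ea _]|[Ef _]].
  by case: ab; rewrite -Ea.
by case: bF; rewrite -Es.
Qed.

(** * Maximal runs when a word is extended *)

Definition inner_run (s : step) (p : seq step) (k : nat) : Prop :=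
  (0 < k)%N /\ exists p1 x p2,
    [/\ p = p1 ++ nseq k s ++ x :: p2, ohead (rev p1) <> Some s & x <> s].

(** Unlike an inner run, which is sealed by a different next step, this one can still grow when the
    word is extended. *)
Definition end_run (s : step) (p : seq step) (k : nat) : Prop :=
  (0 < k)%N /\ exists p1, p = p1 ++ nseq k s /\ ohead (rev p1) <> Some s.

Lemma has_runE s p k : has_run s p k <-> inner_run s p k \/ end_run s p k.
Proof.
split.
  case=> k0 [p1 [[|x p2] [-> H1 H2]]].
    by right; split=> //; exists p1; rewrite cats0.
  by left; split=> //; exists p1, x, p2; split=> // Ex; apply: H2; rewrite Ex.
case=> -[k0].
  by case=> p1 [x [p2 [-> H1 H2]]]; split=> //; exists p1, (x :: p2); split=> // -[].
by case=> p1 [-> H1]; split=> //; exists p1, [::]; rewrite cats0.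
Qed.

Lemma inner_run_rcons s p x k :
  inner_run s (rcons p x) k <-> inner_run s p k \/ x <> s /\ end_run s p k.
Proof.
split.
  case=> k0 [p1 [y [p2 []]]]; case/lastP: p2 => [|p2 z].
    rewrite catA cats1 => /rcons_inj[-> ->] H1 H2.
    by right; split=> //; split=> //; exists p1.
  rewrite -rcons_cons -!rcons_cat => /rcons_inj[-> _] H1 H2.
  by left; split=> //; exists p1, y, p2.
case=> [[k0 [p1 [y [p2 [-> H1 H2]]]]]|[xs [k0 [p1 [-> H1]]]]].
  split=> //; exists p1, y, (rcons p2 x); split=> //.
  by rewrite -rcons_cons -!rcons_cat.
by split=> //; exists p1, x, [::]; rewrite catA cats1.
Qed.

Lemma end_run_rcons s p x k :
  end_run s (rcons p x) k <->
  x = s /\ (k = 1%N /\ ohead (rev p) <> Some s \/ end_run s p k.-1).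
Proof.
split.
  case=> k0 [p1 []]; case: k k0 => // -[|k] _.
    by rewrite cats1 => /rcons_inj[-> ->] H1; split=> //; left.
  rewrite cat_nseqS => /rcons_inj[-> ->] H1; split=> //; right.
  by split=> //; exists p1.
case=> -> [[-> Hp]|[k0 [p1 [-> H1]]]].
  by split=> //; exists p; rewrite cats1.
by case: k k0 => // k k0; split=> //; exists p1; rewrite cat_nseqS.
Qed.

Lemma end_run_nil s k : ~ end_run s [::] k.
Proof. by case=> k0 [[|x p1] []//]; case: k k0. Qed.

Lemma end_run_last s p k : end_run s p k -> ohead (rev p) = Some s.
Proof.
case/lastP: p => [/end_run_nil//|p x] /end_run_rcons[-> _].
by rewrite rev_rcons.
Qed.

Lemma end_run_cat_nseq q r s t k : ohead (rev q) <> Some s ->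
  end_run t (q ++ nseq r.+1 s) k <-> t = s /\ k = r.+1.
Proof.
move=> qs; elim: r k => [|r IH] k.
  rewrite cats1 end_run_rcons; split; last first.
    by case=> -> ->; split=> //; left.
  by case=> <- [[-> _]|/end_run_last].
rewrite cat_nseqS end_run_rcons IH cat_nseqS rev_rcons /=.
split=> [[-> [[_ []]//|[_ Ek]]]|[-> ->]]; last by split=> //; right.
by split=> //; lia.
Qed.

(** The first appended step seals the run that ends [q], which is not a run of [s]; the remaining
    steps only lengthen the new run. *)
Lemma inner_run_cat_nseq q r s t k : ohead (rev q) <> Some s ->
  inner_run t (q ++ nseq r.+1 s) k <-> has_run t q k.
Proof.
move=> qs; elim: r => [|r IH].
  rewrite cats1 inner_run_rcons has_runE; split=> [[|[]]|[|H]]; auto.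
  by right; split=> // Est; apply: qs; rewrite (end_run_last H) Est.
rewrite cat_nseqS inner_run_rcons IH; split; last by left.
by case=> // -[st]; rewrite end_run_cat_nseq // => -[ts]; case: st.
Qed.

Lemma has_run_cat_nseq q r s t k : ohead (rev q) <> Some s ->
  has_run t (q ++ nseq r.+1 s) k <-> has_run t q k \/ t = s /\ k = r.+1.
Proof.
by move=> qs; rewrite has_runE inner_run_cat_nseq // end_run_cat_nseq.
Qed.

Lemma has_run_nil s k : ~ has_run s [::] k.
Proof. by case=> k0 [[|x p1] [p2 []]] //; case: k k0. Qed.

(** * Admissible prefixes *)

Section Counting.

Variables A B C D E : set int.

Definition run_set (s : step) : set int :=
  match s with Up => C | Down => D | Flat => E end.

(** The restrictions without the final return to the axis, so that they make sense for prefixes. *)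
Definition good (p : seq step) : Prop :=
  [/\ nonneg p,
      forall h, turn Up Down p h -> ~ A h,
      forall h, turn Down Up p h -> ~ B h
    & forall s k, has_run s p k -> ~ run_set s k%:Z].

Lemma restricted_motzkinE p :
  restricted_motzkin A B C D E p <-> good p /\ height p = 0.
Proof.
split=> [[[H1 H2] H3 H4 [H5 H6 H7]]|[[H1 H3 H4 H5] H2]].
  by split=> //; split=> // -[].
by split=> //; split; [apply: (H5 Up)|apply: (H5 Down)|apply: (H5 Flat)].
Qed.

Lemma good_nil : good [::].
Proof.
split=> [i|h|h|s k].
- by rewrite /height big_nil.
- by case=> -[|x p1] [p2 [k []]].
- by case=> -[|x p1] [p2 [k []]].
- by move/has_run_nil.
Qed.

(** An appended [Up] can complete only a valley, an appended [Down] only a peak, and a flat step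
    neither. *)
Definition junction (q : seq step) (t : step) : Prop :=
  match t with
  | Up => forall h, open_turn Down q h -> ~ B h
  | Down => forall h, open_turn Up q h -> ~ A h
  | Flat => True
  end.

Lemma junction_flats q r t : junction (q ++ nseq r Flat) t <-> junction q t.
Proof.
by case: t => //=; split=> H h /open_turn_flats Hh; apply: H; apply: Hh.
Qed.

(** A new run affects each restriction separately: one new run length, at most the turn open at the
    end of [q], and one new height to check. *)
Lemma good_cat_nseq q r s : ohead (rev q) <> Some s ->
  good (q ++ nseq r.+1 s) <->
  [/\ good q, ~ run_set s r.+1%:Z, junction q s
    & 0 <= height q + r.+1%:Z * rise s].
Proof.
move=> qs; split.
  case=> /nonneg_cat_nseq[Hq Hr] HA HB HR; split=> //.
  - split=> // [h Hh|h Hh|t k Hk].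
    + by apply: HA; rewrite turn_cat_nseq //; left.
    + by apply: HB; rewrite turn_cat_nseq //; left.
    + by apply: HR; rewrite has_run_cat_nseq //; left.
  - by apply: HR; rewrite has_run_cat_nseq //; right.
  - case: s HA HB {Hr HR qs} => //= HA HB h Hh.
    + by apply: HB; rewrite turn_cat_nseq //; right.
    + by apply: HA; rewrite turn_cat_nseq //; right.
case=> -[Hq HA HB HR] Hs Hj Hr; split.
- by apply/nonneg_cat_nseq.
- move=> h; rewrite turn_cat_nseq // => -[/HA//|[Es]].
  by move: Hj; rewrite Es => /[apply].
- move=> h; rewrite turn_cat_nseq // => -[/HB//|[Es]].
  by move: Hj; rewrite Es => /[apply].
- by move=> t k; rewrite has_run_cat_nseq // => -[/HR//|[-> ->]].
Qed.

(** * Counts of admissible prefixes and their recurrences *)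

(* The prefixes ending in [s] to which a run of [t] may be appended as far as
   peaks and valleys are concerned; [t = Flat] imposes nothing.  The default
   [Down] of [last] lets the empty word end in [Down]. *)
Definition words (t s : step) (m : nat) (n : int) : int :=
  cnt m (fun p => [/\ good p, height p = n & junction p t] /\ last Down p = s).

Lemma words_boundary t s m n : m%:Z < n \/ n < 0 -> words t s m n = 0.
Proof.
move=> Hn; apply: cnt_eq0 => p sp [[[Hp _ _ _] hp _] _].
have := nonneg_height Hp; have := height_size p; rewrite sp hp; lia.
Qed.

Lemma cnt_steps m (P : seq step -> Prop) :
  cnt m P = cnt m (fun p => P p /\ last Down p = Up)
          + cnt m (fun p => P p /\ last Down p = Down)
          + cnt m (fun p => P p /\ last Down p = Flat).
Proof.
rewrite (cntID _ (fun p => last Down p = Up)) -addrA; congr (_ + _).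
rewrite (cntID _ (fun p => last Down p = Down)); congr (_ + _).
  by apply: eq_cnt => p _; split=> [[[]]|[H1 H2]]; do ?split=> //; rewrite H2.
apply: eq_cnt => p _; split=> [[[H1 H2] H3]|[H1 H2]].
  by split=> //; case: (last _ _) H2 H3.
by do ?split=> //; rewrite H2.
Qed.

(** The converse fails for the empty word and [s = Down], because of the default of [last]. *)
Lemma ohead_rev_last p s : last Down p <> s -> ohead (rev p) <> Some s.
Proof. by case/lastP: p => // p x; rewrite last_rcons rev_rcons => H []. Qed.

(* Only one of the two junction conditions is nontrivial: appending flat steps
   preserves [junction _ t], and [junction _ Flat] is [True]. *)
Lemma words_runs t s m n :
  (s = Flat \/ t = Flat) -> (s = Down -> (0 < m)%N /\ 0 <= n) ->
  words t s m n = \sum_(1 <= r < m.+1 | r%:Z \notin run_set s)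
    cnt (m - r) (fun q =>
      [/\ good q, height q = n - r%:Z * rise s & junction q s /\ junction q t]
      /\ last Down q <> s).
Proof.
move=> Hst Hs; rewrite /words cnt_runs; last first.
  (* The word [nseq m Down] ends at height [-m < 0], hence not at [n >= 0]. *)
  move=> Es; have [m0 n0] := Hs Es; rewrite Es => -[_ + _].
  rewrite -[nseq _ _]cat0s height_cat_nseq /height big_nil /=; lia.
rewrite [RHS]big_mkcond; apply: eq_big_nat => -[//|r] /andP[_ rm].
have Ht q : junction q t -> junction (q ++ nseq r.+1 s) t.
  by case: Hst => ->; rewrite ?junction_flats.
have Ht' q : junction (q ++ nseq r.+1 s) t -> junction q t.
  by case: Hst => ->; rewrite ?junction_flats.
case: ifPn => [/negP rX|/negPn rX].
  apply: eq_cnt => q _; split.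
    case=> -[] + hq jq qs; rewrite good_cat_nseq; last exact: ohead_rev_last.
    case=> gq _ js _; split=> //; split=> //; last by split=> //; exact: Ht'.
    by rewrite -hq height_cat_nseq addrK.
  case=> -[gq hq [js jt]] qs; split=> //; split; last exact: Ht.
    rewrite good_cat_nseq; last exact: ohead_rev_last.
    split=> //; first by move=> rX'; apply: rX; rewrite inE.
    (* The final height is [n]: for [Up] and [Flat] it is at least [height q], for [Down] it is
       nonnegative by [Hs]. *)
    have := nonneg_height (let: And4 H _ _ _ := gq in H).
    by rewrite hq; case: (s) Hs => /= Hs; try (have [] := Hs erefl); lia.
  by rewrite height_cat_nseq hq subrK.
apply: cnt_eq0 => q _ [[+ _ _] qs].
rewrite good_cat_nseq; last exact: ohead_rev_last.
by case=> _ []; rewrite inE in rX.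
Qed.

(** After an [Up] no valley is open, and after a [Down] no peak is, so the junction condition is
    vacuous for [t = s]. *)
Lemma words_turn_free t s m n : (t = Flat \/ t = s) -> s <> Flat ->
  words t s m n = words Flat s m n.
Proof.
move=> Ht sF; apply: eq_cnt => p _; split=> [[[]]//|[[H1 H2 _] Hs]].
split=> //; split=> //; case: Ht => -> //.
by case: s sF Hs => //= _ Hs h /open_turn_last-[]//; rewrite Hs.
Qed.

Lemma junction_Up_Down p : ~ B 0 -> last Down p = Down ->
  junction p Up <-> ~ B (height p).
Proof.
move=> B0; case/lastP: p => [_|p x].
  (* The empty word has no open turn, and its height 0 avoids [B] by [B0]. *)
  by rewrite /height big_nil; split=> // _ h /open_turn_nil.
rewrite last_rcons => -> /=; split=> [H|H h].
  by apply: H; rewrite open_turn_rcons //; left; rewrite height_rcons.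
by rewrite open_turn_rcons // => -[[_ ->]|[]//]; rewrite height_rcons in H.
Qed.

Lemma junction_Down_Up p : last Down p = Up ->
  junction p Down <-> ~ A (height p).
Proof.
case/lastP: p => // p x; rewrite last_rcons => -> /=; split=> [H|H h].
  by apply: H; rewrite open_turn_rcons //; left; rewrite height_rcons.
by rewrite open_turn_rcons // => -[[_ ->]|[]//]; rewrite height_rcons in H.
Qed.

Lemma words_Up_Down m n : ~ B 0 ->
  words Up Down m n = d_u B (words Flat Down) m n.
Proof.
move=> B0; rewrite /d_u; case: ifPn => [/set_mem nB|/negP nB].
  by apply: cnt_eq0 => p _ [[_ hp /junction_Up_Down+] Hp] => /(_ B0 Hp); rewrite hp.
apply: eq_cnt => p _; split=> [[[]]//|[[H1 H2 _] Hp]].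
split=> //; split=> //; apply/junction_Up_Down => //.
by rewrite H2 => nB'; apply: nB; rewrite inE.
Qed.

Lemma words_Down_Up m n : words Down Up m n = u_d A (words Flat Up) m n.
Proof.
rewrite /u_d; case: ifPn => [/set_mem nA|/negP nA].
  by apply: cnt_eq0 => p _ [[_ hp /junction_Down_Up+] Hp] => /(_ Hp); rewrite hp.
apply: eq_cnt => p _; split=> [[[]]//|[[H1 H2 _] Hp]].
split=> //; split=> //; apply/junction_Down_Up => //.
by rewrite H2 => nA'; apply: nA; rewrite inE.
Qed.

(** The case [t = Flat] is the recurrence of [f]; [t = Up] and [t = Down] correspond to [f_u] and
    [f_d], since flat steps leave an open turn open. *)
Lemma words_through_flats t m n :
  words t Flat m n =
  \sum_(1 <= r < m.+1 | r%:Z \notin E)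
    (words t Up (m - r) n + words t Down (m - r) n).
Proof.
rewrite words_runs //; last by left.
apply: eq_bigr => r _; rewrite cnt_steps mulr0 subr0.
rewrite [X in _ + X]cnt_eq0 ?addr0; last by move=> p _ [[]].
by congr (_ + _); apply: eq_cnt => p _; split=> [[[[? ? []]]]|[[? ? ?] Hp]];
  do ?split=> //; rewrite Hp.
Qed.

Lemma words_Flat_Up m n :
  words Flat Up m n =
  \sum_(1 <= r < m.+1 | r%:Z \notin C)
    (words Up Down (m - r) (n - r%:Z) + words Up Flat (m - r) (n - r%:Z)).
Proof.
rewrite words_runs //; last by right.
apply: eq_bigr => r _; rewrite cnt_steps mulr1.
rewrite [X in X + _ + _]cnt_eq0 ?add0r; last by move=> p _ [[]].
by congr (_ + _); apply: eq_cnt => p _; split=> [[[[? ? []]]]|[[? ? ?] Hp]];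
  do ?split=> //; rewrite Hp.
Qed.

(** At [m = n = 0] the sum is empty although the empty word counts 1; for [n < 0] the sum could
    count runs that cross the axis. *)
Lemma words_Flat_Down m n : (0 < m)%N -> 0 <= n ->
  words Flat Down m n =
  \sum_(1 <= r < m.+1 | r%:Z \notin D)
    (words Down Up (m - r) (n + r%:Z) + words Down Flat (m - r) (n + r%:Z)).
Proof.
move=> m0 n0; rewrite words_runs //; last by right.
apply: eq_bigr => r _; rewrite cnt_steps mulrN1 opprK.
rewrite [X in _ + X + _]cnt_eq0 ?addr0; last by move=> p _ [[]].
by congr (_ + _); apply: eq_cnt => p _; split=> [[[[? ? []]]]|[[? ? ?] Hp]];
  do ?split=> //; rewrite Hp.
Qed.

(** Before its last step such a word would be at height -1. *)
Lemma words_Up_ground m : words Flat Up m 0 = 0.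
Proof.
apply: cnt_eq0 => p _ [[[+ _ _ _] + _]]; case/lastP: p => // p x.
rewrite last_rcons height_rcons => /nonneg_rcons[/nonneg_height Hp _] hp Ex.
by move: hp; rewrite Ex /=; lia.
Qed.

Lemma card_restricted_motzkin N :
  #|[pred p : N.-tuple step | `[< restricted_motzkin A B C D E p >]]|%:Z
  = words Flat Down N 0 + words Flat Flat N 0.
Proof.
rewrite -(cntE N (restricted_motzkin A B C D E)).
have wordsE s :
    cnt N (fun p => restricted_motzkin A B C D E p /\ last Down p = s)
    = words Flat s N 0.
  apply: eq_cnt => p _.
  by rewrite restricted_motzkinE; split=> [[[? ?] ?]|[[? ? _] ?]].
by rewrite cnt_steps !wordsE words_Up_ground add0r.
Qed.

(** * Agreement of the recursive functions with the counts *)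

Variables u d f : nat -> int -> int.

(** Since [r >= 1], [f_u] at length [m] reads [u] and [d] only at smaller lengths, where the
    induction hypothesis applies. *)
Lemma f_uE m n : ~ B 0 ->
  (forall k, (k < m)%N -> forall j,
     u k j = words Flat Up k j /\ d k j = words Flat Down k j) ->
  f_u B E u d m n = words Up Flat m n.
Proof.
move=> B0 IH; rewrite words_through_flats /f_u.
rewrite big_nat_cond [RHS]big_nat_cond; apply: eq_bigr => r /andP[/andP[r0 rm] _].
have lt_m : (m - r < m)%N by lia.
rewrite words_Up_Down // /d_u (IH _ lt_m n).1 (IH _ lt_m n).2.
by rewrite (@words_turn_free Up) //; right.
Qed.

Lemma f_dE m n :
  (forall k, (k < m)%N -> forall j,
     u k j = words Flat Up k j /\ d k j = words Flat Down k j) ->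
  f_d A E u d m n = words Down Flat m n.
Proof.
move=> IH; rewrite words_through_flats /f_d.
rewrite big_nat_cond [RHS]big_nat_cond; apply: eq_bigr => r /andP[/andP[r0 rm] _].
have lt_m : (m - r < m)%N by lia.
rewrite words_Down_Up // /u_d (IH _ lt_m n).1 (IH _ lt_m n).2.
by rewrite (@words_turn_free Down) //; right.
Qed.

End Counting.

Theorem mainTheorem1 (A B C D E : set int)
  (hA : admissible A) (hB : admissible B) (hC : admissible C)
  (hD : admissible D) (hE : admissible E)
  (u d f : nat -> int -> int)
  (u00 : u 0%N 0 = 0) (f00 : f 0%N 0 = 0) (d00 : d 0%N 0 = 1)
  (boundary : forall (m : nat) (n : int), m%:Z < n \/ n < 0 ->
     [/\ u m n = 0, d m n = 0 & f m n = 0])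
  (d_rec : forall (m : nat) (n : int), (1 <= m)%N -> 0 <= n <= m%:Z ->
     d m n = \sum_(1 <= r < m.+1 | r%:Z \notin D)
       (u_d A u (m - r)%N (n + r%:Z) + f_d A E u d (m - r)%N (n + r%:Z)))
  (f_rec : forall (m : nat) (n : int), (1 <= m)%N -> 0 <= n <= m%:Z ->
     f m n = \sum_(1 <= r < m.+1 | r%:Z \notin E)
       (d (m - r)%N n + u (m - r)%N n))
  (u_rec : forall (m : nat) (n : int), (1 <= m)%N -> 0 <= n <= m%:Z ->
     u m n = \sum_(1 <= r < m.+1 | r%:Z \notin C)
       (d_u B d (m - r)%N (n - r%:Z) + f_u B E u d (m - r)%N (n - r%:Z)))
  (N : nat) :
  #|[pred p : N.-tuple step | `[< restricted_motzkin A B C D E p >]]|%:Z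
    = d N 0 + f N 0.
Proof.
have B0 : ~ B 0 by move/hB.1; rewrite ltxx.
pose w := words A B C D E.
suff uE m : forall n, [/\ u m n = w Flat Up m n, d m n = w Flat Down m n
                        & f m n = w Flat Flat m n].
  by rewrite card_restricted_motzkin; case: (uE N 0) => _ -> ->.
elim/ltn_ind: m => m IH n.
have IHud k (km : (k < m)%N) j :
  u k j = w Flat Up k j /\ d k j = w Flat Down k j by case: (IH k km j).
(* The recurrences are given only in this range; outside it both sides vanish. *)
have [n_in|n_out] := boolP (0 <= n <= m%:Z); last first.
  have Hn : m%:Z < n \/ n < 0 by lia.
  by rewrite /w !words_boundary //; apply: boundary.
case: m IH IHud n_in => [|m] IH IHud n_in.
  (* At length 0 only the empty word occurs; it is counted as ending in [Down], which matches
     [d00]. *)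
  have {n_in} -> : n = 0 by lia.
  rewrite u00 d00 f00 /w words_Up_ground words_through_flats big_geq //.
  split=> //; rewrite /words cnt_nil //; split=> //; split=> //.
    exact: good_nil.
  by rewrite /height big_nil.
have n0 : 0 <= n by case/andP: n_in.
rewrite u_rec // d_rec // f_rec // /w words_Flat_Up words_Flat_Down //.
rewrite words_through_flats.
split; rewrite big_nat_cond [RHS]big_nat_cond; apply: eq_bigr => r /andP[/andP[r0 rm] _];
  have lt_m : (m.+1 - r < m.+1)%N by lia.
(* [f_u] is evaluated at length [m.+1 - r] and looks below it, so the induction hypothesis is
   restricted accordingly. *)
- have IHr k (km : (k < m.+1 - r)%N) := IHud k (ltn_trans km lt_m).
  by rewrite words_Up_Down // (f_uE _ B0 IHr) /d_u (IHud _ lt_m _).2.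
- have IHr k (km : (k < m.+1 - r)%N) := IHud k (ltn_trans km lt_m).
  by rewrite words_Down_Up (f_dE _ IHr) /u_d (IHud _ lt_m _).1.
- by rewrite (IHud _ lt_m _).1 (IHud _ lt_m _).2 addrC.
Qed.
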